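(* Let $n\ge 10$ be an integer and let $F(n)$ be the number of faces in a random embedding of the complete graph $K_n$. Then $\mathbb{E}[F(n)]<H_{n-3}H_{n-2}$, where $H_k=\sum_{j=1}^k\frac1j$ denotes the $k$-th harmonic number.
   Context: A rotation system of a graph $G$ is a choice, for each vertex $v$, of a cyclic permutation $R_v$ (a single cycle) of the darts at $v$, where a dart is a pair $(v,e)$ with $e$ an edge incident with $v$. Let $R$ be the product of all $R_v$, and let $L$ be the fixed-point-free involution on the set of all darts that swaps the two darts $(u,e),(v,e)$ of each edge $e=uv$. Rotation systems correspond to (equivalence classes of) 2-cell embeddings of a connected graph $G$ in oriented closed surfaces; the faces of the embedding are the cycles of $R\circ L$. A random embedding of $G$ is one given by a rotation system chosen uniformly at random among all $\prod_{v}(\deg(v)-1)!$ rotation systems. *)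

(* Defs.v *)
From HB Require Import structures.
From mathcomp Require Import all_boot all_order all_algebra all_fingroup.

Set Implicit Arguments.
Unset Strict Implicit.
Unset Printing Implicit Defensive.

Import GRing.Theory Num.Theory.

Record sgraph := SGraph {
  vertex : finType;
  adj : rel vertex;
  adj_sym : symmetric adj;
  adj_irr : irreflexive adj }.

Section Rotation.
Variable G : sgraph.

(* As G is simple, the dart (u, e) with e = uv is encoded by the ordered pair
   (u, v) of its vertex and the other end of e. *)
Record dart := Dart {
  ends : vertex G * vertex G;
  ends_adj : adj ends.1 ends.2 }.

HB.instance Definition _ := [isSub for ends].
HB.instance Definition _ := [Finite of dart by <:].

Definition darts_at (v : vertex G) : {set dart} := [set d | (ends d).1 == v].

Lemma flip_subproof (d : dart) : adj (ends d).2 (ends d).1.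
Proof. by rewrite adj_sym; exact: ends_adj. Qed.

Definition flip (d : dart) : dart :=
  @Dart ((ends d).2, (ends d).1) (flip_subproof d).

Lemma flipK : involutive flip.
Proof. by move=> d; apply: val_inj => /=; case: (ends d). Qed.

Definition flip_perm : {perm dart} := perm (inv_inj flipK).

(* s is a single cycle on A and fixes everything outside A; for A empty, s is
   the identity. *)
Definition cyclic_perm_on (A : {set dart}) (s : {perm dart}) : bool :=
  perm_on A s && [forall d in A, porbit s d == A].

Definition rotation_systems : {set {ffun vertex G -> {perm dart}}} :=
  [set R : {ffun vertex G -> {perm dart}} |
    [forall v, cyclic_perm_on (darts_at v) (R v)]].

(* The factors have pairwise disjoint supports, so the order is irrelevant. *)
Definition rotation_prod (R : {ffun vertex G -> {perm dart}}) : {perm dart} :=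
  (\prod_(v : vertex G) R v)%g.

(* The product of permutations applies its left factor first, so that
   flip_perm * rotation_prod R is the composite "rotation_prod R after flip_perm". *)
Definition num_faces (R : {ffun vertex G -> {perm dart}}) : nat :=
  #|porbits (flip_perm * rotation_prod R)%g|.

End Rotation.

Local Open Scope ring_scope.

(* Expectation of X at a uniformly random element of A. *)
Definition uniform_expectation (T : finType) (A : {set T}) (X : T -> rat) : rat :=
  (\sum_(a in A) X a) / #|A|%:R.

Definition expected_faces (G : sgraph) : rat :=
  uniform_expectation (rotation_systems G) (fun R => (num_faces R)%:R).

Lemma neq_sym (T : eqType) : symmetric (fun x y : T => x != y).
Proof. by move=> x y; rewrite eq_sym. Qed.

Lemma neq_irr (T : eqType) : irreflexive (fun x y : T => x != y).
Proof. by move=> x; rewrite eqxx. Qed.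

Definition complete_graph (n : nat) : sgraph :=
  @SGraph 'I_n (fun x y => x != y) (@neq_sym 'I_n) (@neq_irr 'I_n).

Definition harmonic_number (k : nat) : rat := \sum_(1 <= j < k.+1) (j%:R)^-1.

(* Main.v *)
(* Order the vertices 0 < ... < n-1 and charge every face to its dart (k, w) that
   is lexicographically maximal; then w < k.  Expose the rotations along the face
   walk that starts at (k, w).  When the walk first leaves {0, ..., k-1}, the
   vertices k, ..., n-1 are interchangeable, except that an exit at k can only be
   blocked by the requirement that rotations are single cycles; so it comes back
   to k with probability at most 1/(n-k).  Once it is back at k, every new value
   of the rotation at k closes the face with at most the chance of a uniform
   choice, and only the w darts (k, w') with w' < w let the walk go on, so it
   closes with probability at most 1/(n-2-w).  Hence
     E[F(n)] <= 1 + sum_(w < k, w < n-2) 1/((n-k)(n-2-w)),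
   and an elementary estimate with harmonic numbers concludes. *)
Require Import Defs.
From mathcomp Require Import all_boot all_order all_algebra all_fingroup.
From mathcomp Require Import zify lra.

Set Implicit Arguments.
Unset Strict Implicit.
Unset Printing Implicit Defensive.

Import Order.TTheory GRing.Theory Num.Theory.

(** * Permutations with prescribed cycles and prescribed values *)

Section Cylinders.
Local Open Scope group_scope.
Variable D : finType.
Implicit Types (s t : {perm D}) (e : rel D) (x y a b u z : D) (S : seq (D * D)).

Lemma mem_porbit_perm s a b : (s b \in porbit s a) = (b \in porbit s a).
Proof.
rewrite -!eq_porbit_mem; congr (_ == _); apply/eqP.
by rewrite eq_porbit_mem; have := mem_porbit s 1 b; rewrite expg1.
Qed.

Lemma mem_porbit_fix s x b : s x = x -> (b \in porbit s x) = (b == x).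
Proof.
move=> sx; apply/porbitP/eqP => [[i ->]|->]; first exact: permX_fix.
by exists 0; rewrite expg0 perm1.
Qed.

(** The product with [tperm x (s x)] cuts [x] out of its cycle: the predecessor of [x] is sent to
    [s x], and [x] becomes a fixed point. *)
Lemma porbit_tperm_sub s x a : {subset porbit (s * tperm x (s x)) a <= porbit s a}.
Proof.
set t := (s * _)%g.
move=> _ /porbitP[i ->]; elim: i => [|i IH]; first by rewrite expg0 perm1 porbit_id.
rewrite expgSr permM; move: IH; set c := (t ^+ i)%g a => IH.
rewrite /t permM; case: tpermP => [sc|/perm_inj <- //|_ _]; last by rewrite mem_porbit_perm.
by rewrite mem_porbit_perm -sc mem_porbit_perm.
Qed.

Lemma mem_porbit_mul_tperm s x a b : a != x -> b != x ->
  (b \in porbit (s * tperm x (s x)) a) = (b \in porbit s a).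
Proof.
move=> ax bx; apply/idP/idP; first exact: porbit_tperm_sub.
have [->|neq_x] := eqVneq (s x) x; first by rewrite tperm1 mulg1.
set t := (s * _)%g.
have tE c : c != x -> t c = if s c == x then s x else s c.
  move=> cx; rewrite /t permM; case: tpermP => [->|/perm_inj ex|/eqP/negPf -> //].
    by rewrite eqxx.
  by rewrite ex eqxx in cx.
(* Each point of the [s]-walk from [a] lies on the shortened cycle, except [x], in whose place [s x]
   does. *)
suff H i : let c := (s ^+ i)%g a in
    (c != x) && (c \in porbit t a) || (c == x) && (s x \in porbit t a).
  by case/porbitP=> i bE; have := H i; rewrite /= -bE (negPf bx) orbF => /andP[].
elim: i => [|i IH] /=; first by rewrite expg0 perm1 ax porbit_id.
rewrite expgSr permM; move: IH => /=; set c := (s ^+ i)%g a.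
case/orP=> /andP[cx ct]; last by rewrite (eqP cx) neq_x ct.
by have := mem_porbit_perm t a c; rewrite ct tE //; case: eqP => //= _ ->.
Qed.

Section CyclesOn.
Variable T : eqType.
Implicit Types f : D -> T.

(** For [f] the tail of a dart these are the products of rotation systems. The label type is
    arbitrary because contraction changes the labels. *)
Definition cycles_on f : {set {perm D}} :=
  [set s : {perm D} | [forall x, forall y, (y \in porbit s x) == (f x == f y)]].

Lemma cycles_onP f s :
  reflect (forall x y, (y \in porbit s x) = (f x == f y)) (s \in cycles_on f).
Proof.
rewrite inE; apply: (iffP forallP) => [H x y|H x]; first by have /forallP/(_ y)/eqP := H x.
by apply/forallP=> y; rewrite H.
Qed.

Lemma cycles_on_perm f s x : s \in cycles_on f -> f (s x) = f x.
Proof. by move/cycles_onP=> H; apply/esym/eqP; rewrite -H mem_porbit_perm porbit_id. Qed.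

(** The sum type supplies fresh labels: once the arc leaving a source is contracted, that source is
    a fixed point and needs a fibre of its own. *)
Definition isolate (X : seq D) f (x : D) : D + T :=
  if x \in X then inl x else inr (f x).

Lemma isolate_eq X f a b :
  (isolate X f a == isolate X f b) =
  (a == b) || [&& a \notin X, b \notin X & f a == f b].
Proof.
rewrite /isolate; have [->|neq_ab] := eqVneq a b; first by rewrite eqxx.
by case: ifP => aX; case: ifP => bX //=; apply/eqP => -[/eqP]; rewrite (negPf neq_ab).
Qed.

End CyclesOn.

(* A prescribed arc x -> y is removed by contraction: composing with the
   transposition (x y) turns x into a singleton cycle. *)
Lemma contract_arc (T : eqType) (f : D -> T) s0 x y : s0 \in cycles_on f -> s0 x = y ->
  forall s, (s \in cycles_on f) && (s x == y) =
            (s * tperm x y \in cycles_on (isolate [:: x] f)).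
Proof.
move=> s0f s0x s; have fxy : f y = f x by rewrite -s0x; exact: cycles_on_perm s0f.
(* If the arc is a loop, [s0] fixes [x], so the fibre of [x] is a singleton. *)
have single : x = y -> forall b, (f x == f b) = (b == x).
  move=> exy b; have /cycles_onP <- := s0f; rewrite mem_porbit_fix // s0x; exact/esym.
apply/andP/idP => [[/cycles_onP sf /eqP sx]|/cycles_onP sf].
  apply/cycles_onP=> a b; rewrite isolate_eq !inE -sx.
  have fix_x : (s * tperm x (s x))%g x = x by rewrite permM tpermR.
  have [->|ax] := eqVneq a x; first by rewrite orbF eq_sym mem_porbit_fix.
  have [->|bx] := eqVneq b x.
    by rewrite porbit_sym mem_porbit_fix // (negPf ax).
  rewrite mem_porbit_mul_tperm // sf /=.
  by case: (eqVneq a b) => [->|] //; rewrite eqxx.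
(* The contracted permutation fixes [x], which is alone in its fibre; undoing the transposition
   gives the arc. *)
have sx : s x = y.
  have /esym := sf x ((s * tperm x y) x)%g.
  rewrite mem_porbit_perm porbit_id isolate_eq !inE eqxx orbF => /eqP /esym.
  by rewrite permM => /(canRL (tpermK x y)); rewrite tpermL.
split; last exact/eqP; apply/cycles_onP=> a b; subst y.
have sE c d : c != x -> d != x -> (d \in porbit s c) = (f c == f d).
  move=> cx dx; rewrite -(mem_porbit_mul_tperm s cx dx) sx sf isolate_eq !inE cx dx.
  by case: (eqVneq c d) => [->|] //; rewrite eqxx.
have [fix_x|yx] := eqVneq (s0 x) x.
  have [->|ax] := eqVneq a x; first by rewrite mem_porbit_fix ?sx // single.
  have [->|bx] := eqVneq b x; last exact: sE.
  by rewrite porbit_sym mem_porbit_fix ?sx // (eq_sym (f a)) single.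
have to_y c : (c \in porbit s x) = (c \in porbit s (s0 x)).
  by rewrite -sx porbit_sym -mem_porbit_perm porbit_sym.
have [->|ax] := eqVneq a x; last first.
  have [->|bx] := eqVneq b x; last exact: sE.
  by rewrite porbit_sym to_y sE // fxy eq_sym.
rewrite to_y -fxy; have [->|bx] := eqVneq b x; last exact: sE.
by rewrite -to_y porbit_id fxy eqxx.
Qed.

Lemma eq_cycles_on (T T' : eqType) (f : D -> T) (g : D -> T') :
  (forall a b, (f a == f b) = (g a == g b)) -> cycles_on f = cycles_on g.
Proof.
move=> fg; apply/setP=> s; rewrite !inE.
by apply: eq_forallb => a; apply: eq_forallb => b; rewrite fg.
Qed.

(** If the first set is nonempty, conjugation by the transposition of [u] and [u'] preserves the
    fibres of [g] and fixes [x], so it injects the first set into the second. *)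
Lemma leq_cycles_on_switch (T : eqType) (g : D -> T) x u u' :
    g x = g u' -> x != u' ->
  #|[set s in cycles_on g | s x == u]| <= #|[set s in cycles_on g | s x == u']|.
Proof.
move=> gu' xu'; have [->|[s0]] := set_0Vmem [set s in cycles_on g | s x == u].
  by rewrite cards0.
rewrite inE => /andP[s0g /eqP s0x].
have gu : g x = g u by rewrite -s0x (cycles_on_perm x s0g).
have xu : x != u.
  apply/eqP=> xu; have /cycles_onP/(_ x u') := s0g.
  by rewrite gu' eqxx mem_porbit_fix ?s0x -?xu // eq_sym (negPf xu').
pose c := tperm u u'; have cK : involutive c := tpermK u u'.
have gc z : g (c z) = g z by rewrite /c; case: tpermP => [->|->|//]; rewrite -gu -gu'.
rewrite -(card_imset _ (conjg_inj c)); apply/subset_leq_card/subsetP=> _ /imsetP[s + ->].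
rewrite !inE => /andP[sg /eqP sx]; apply/andP; split.
  apply/forallP=> a; apply/forallP=> b; apply/eqP.
  have /forallP/(_ (c a))/forallP/(_ (c b))/eqP := sg; rewrite !gc => <-.
  apply/idP/idP => /porbitP[i E]; apply/porbitP; exists i.
    by rewrite E -conjXg -[a in LHS]cK permJ cK.
  by rewrite -[LHS]cK E -permJ cK conjXg.
have cx : c x = x by rewrite tpermD // eq_sym.
by rewrite -{1}cx permJ sx /c tpermL.
Qed.

(** By the switch, every point other than [x] in its fibre is at least as frequent a value at [x] as
    [z], and different values are disjoint events. *)
Lemma card_cycles_on_arc (T : eqType) (g : D -> T) x z :
  #|[set s in cycles_on g | s x == z]| * #|[set b | g x == g b]|.-1
    <= #|cycles_on g|.
Proof.
have -> : #|[set b | g x == g b]|.-1 = #|[set b | g x == g b] :\ x|.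
  by rewrite (cardsD1 x) inE eqxx.
rewrite -[leqRHS]sum1_card (partition_big (fun s : {perm D} => s x) predT) //=.
rewrite (bigID (fun b => b \in [set b | g x == g b] :\ x)) /=.
apply: leq_trans (leq_addr _ _); rewrite mulnC -sum_nat_const; apply: leq_sum => b.
rewrite !inE => /andP[bx /eqP gb]; rewrite sum1_card.
apply: leq_trans (leq_cycles_on_switch z gb _) _; first by rewrite eq_sym.
by apply: eq_leq; apply: eq_card => s; rewrite inE.
Qed.

(** * Counting permutations with several prescribed arcs *)

Section Arcs.
Variable T : eqType.
Implicit Types (f : D -> T) (Q : {perm D} -> bool).

Definition cylinder f S : {set {perm D}} :=
  [set s in cycles_on f | all (fun p => s p.1 == p.2) S].

Lemma in_cylinder_cons f p S s :
  (s \in cylinder f (p :: S)) = (s p.1 == p.2) && (s \in cylinder f S).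
Proof. by rewrite !inE /= andbCA. Qed.

Lemma cylinder_perm f S s x : s \in cylinder f S -> f (s x) = f x.
Proof. by rewrite inE => /andP[/cycles_on_perm -> ]. Qed.

(** The arcs are contracted one by one, and [q] is the product of the transpositions. It moves only
    endpoints of arcs in [S], so a dart not yet seen is unaffected. *)
Lemma contract_arcs f S s0 : s0 \in cylinder f S ->
  exists2 q : {perm D}, forall z, z \notin unzip1 S -> z \notin unzip2 S -> q z = z &
    forall s, (s \in cylinder f S) = (s * q \in cycles_on (isolate (unzip1 S) f)).
Proof.
elim: S => [|[a b] S IH] /=.
  move=> _; exists 1 => [z _ _|s]; first exact: perm1.
  rewrite mulg1 inE andbT; rewrite (@eq_cycles_on _ _ (isolate [::] f) f) // => c d.
rewrite in_cylinder_cons => /andP[/eqP /= s0a s0S]; have [q qfix qE] := IH s0S.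
(* After contraction of [S] the arc from [a] to [b] has become one from [a] to [q b]. *)
exists (q * tperm a (q b)) => [z|s].
  rewrite !inE !negb_or => /andP[za zS] /andP[zb zS'].
  have qz := qfix z zS zS'; rewrite permM qz tpermD 1?eq_sym //.
  by rewrite -{1}qz (inj_eq perm_inj).
rewrite in_cylinder_cons /= andbC qE mulgA -(inj_eq (@perm_inj _ q)) -permM.
rewrite (@contract_arc _ _ (s0 * q)) -?qE ?permM ?s0a //.
rewrite (@eq_cycles_on _ _ _ (isolate (a :: unzip1 S) f)) // => c d.
rewrite !isolate_eq !inE !negb_or.
by case: (eqVneq c d) => //= _; rewrite -!andbA; do !bool_congr; rewrite andbCA.
Qed.

Lemma contract_cylinder f S : cylinder f S != set0 ->
  exists2 q : {perm D}, forall z, z \notin unzip1 S -> z \notin unzip2 S -> q z = z &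
    #|cylinder f S| = #|cycles_on (isolate (unzip1 S) f)| /\
    forall x z, #|cylinder f ((x, z) :: S)| =
      #|[set s in cycles_on (isolate (unzip1 S) f) | s x == q z]|.
Proof.
case/set0Pn=> s0 /contract_arcs[q qfix qE]; exists q => //.
have E (A B : {set {perm D}}) : (forall s, (s \in A) = (s * q \in B)) -> #|A| = #|B|.
  move=> AB; rewrite -(card_imset _ (mulIg q)); congr #|pred_of_set _|; apply/setP=> s.
  by rewrite -[s](mulgKV q) (mem_imset _ _ (mulIg q)) AB.
split=> [|x z]; first exact: E.
by apply: E => s; rewrite in_cylinder_cons qE [RHS]inE permM (inj_eq perm_inj) andbC.
Qed.

(** After contraction of [S] the fibre of [x] consists of the sources still free, and
    [card_cycles_on_arc] applies there. *)
Lemma card_cylinder_cons f S x z : x \notin unzip1 S ->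
  #|cylinder f ((x, z) :: S)| * #|[set b | (f x == f b) && (b \notin unzip1 S)]|.-1
    <= #|cylinder f S|.
Proof.
move=> xS; have [S0|/contract_cylinder[q _ [-> ->]]] := eqVneq (cylinder f S) set0.
  rewrite (_ : cylinder f (_ :: _) = set0) ?cards0 //; apply/eqP; rewrite -subset0 -S0.
  by apply/subsetP=> s; rewrite in_cylinder_cons => /andP[].
apply: leq_trans (card_cycles_on_arc _ x (q z)); rewrite leq_mul2l; apply/orP; right.
rewrite -!subn1 leq_sub2r //; apply/subset_leq_card/subsetP=> b.
by rewrite !inE isolate_eq xS => /andP[-> ->]; rewrite orbT.
Qed.

(** A target [u'] untouched by [S] survives contraction as a value distinct from [x], whereas [u]
    may stand for a value that closes a cycle too early; hence only an inequality. *)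
Lemma leq_cylinder_switch f S x u u' :
    f x = f u' -> x != u' -> x \notin unzip1 S -> u' \notin unzip1 S ->
    u' \notin unzip2 S ->
  #|cylinder f ((x, u) :: S)| <= #|cylinder f ((x, u') :: S)|.
Proof.
move=> fxu xu' xS uS uS'.
have [S0|/contract_cylinder[q qfix [_ E]]] := eqVneq (cylinder f S) set0.
  rewrite (_ : cylinder f ((x, u) :: _) = set0) ?cards0 //; apply/eqP.
  rewrite -subset0 -S0.
  by apply/subsetP=> s; rewrite in_cylinder_cons => /andP[].
rewrite !E (qfix u') //; apply: leq_cycles_on_switch => //; apply/eqP.
by rewrite isolate_eq xS uS fxu eqxx orbT.
Qed.

(** A division-free substitute for the conditional probability of [Q] given the exposed arcs [S]. *)
Definition count_cyl f S Q := #|[set s in cylinder f S | Q s]|.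

Lemma count_cyl_le f S Q : count_cyl f S Q <= #|cylinder f S|.
Proof. by apply: subset_leq_card; apply/subsetP => s; rewrite inE => /andP[]. Qed.

Lemma eq_count_cyl f S Q Q' : {in cylinder f S, Q =1 Q'} -> count_cyl f S Q = count_cyl f S Q'.
Proof.
move=> QQ'; apply: eq_card => s; rewrite [LHS]in_set [RHS]in_set.
by apply: andb_id2l => /QQ'.
Qed.

Lemma count_cyl_false f S Q : {in cylinder f S, forall s, Q s = false} -> count_cyl f S Q = 0.
Proof.
move=> Q0; apply: eq_card0 => s; rewrite [LHS]inE.
by apply/andP => -[/Q0 ->].
Qed.

Lemma cylinder_arc f S s x y : (x, y) \in S -> s \in cylinder f S -> s x = y.
Proof. by move=> xyS; rewrite inE => /andP[_ /allP/(_ _ xyS)/eqP]. Qed.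

Lemma count_cyl_split f S Q x : count_cyl f S Q = \sum_y count_cyl f ((x, y) :: S) Q.
Proof.
rewrite /count_cyl -sum1_card (partition_big (fun s : {perm D} => s x) predT) //=.
apply: eq_bigr => y _; rewrite sum1_card; apply: eq_card => s.
by rewrite [RHS]in_set in_cylinder_cons [LHS]andbC in_set andbA.
Qed.

Lemma card_cylinder_split f S x : #|cylinder f S| = \sum_y #|cylinder f ((x, y) :: S)|.
Proof.
have cE S' : #|cylinder f S'| = count_cyl f S' predT
  by apply: eq_card => s; rewrite [RHS]inE andbT.
by rewrite cE (count_cyl_split _ _ _ x); apply: eq_bigr => y _; rewrite cE.
Qed.

End Arcs.
End Cylinders.

(** * Face walks in the complete graph *)

Section Walks.
Local Open Scope nat_scope.
Variable n : nat.
Notation D := (dart (complete_graph n)).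
Implicit Types (d x y : D) (s : {perm D}) (S : seq (D * D)) (Q : {perm D} -> bool).

Definition tail d : nat := (ends d).1.
Definition head d : nat := (ends d).2.

Lemma tail_flip d : tail (flip d) = head d. Proof. by []. Qed.
Lemma head_flip d : head (flip d) = tail d. Proof. by []. Qed.

Lemma dart_eq d d' : tail d = tail d' -> head d = head d' -> d = d'.
Proof.
by move=> t h; apply/val_inj/eqP; rewrite -pair_eqE /=; apply/andP; split; apply/eqP/val_inj.
Qed.

Lemma tail_neq_head d : tail d != head d.
Proof. by apply/eqP => /val_inj e; have := ends_adj d; rewrite /= e eqxx. Qed.

Lemma tail_lt d : tail d < n. Proof. exact: ltn_ord. Qed.
Lemma head_lt d : head d < n. Proof. exact: ltn_ord. Qed.

Lemma ex_dart v w : v < n -> w < n -> v != w -> exists2 d, tail d = v & head d = w.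
Proof.
move=> vn wn vw; have vw' : adj (Ordinal vn : vertex (complete_graph n)) (Ordinal wn) by [].
by exists (@Dart (complete_graph n) (Ordinal vn, Ordinal wn) vw').
Qed.

Lemma card_heads v (A : pred nat) : v < n ->
  #|[set d | (tail d == v) && A (head d)]| = #|[set w : 'I_n | (w != v :> nat) && A w]|.
Proof.
move=> vn; pose h d : 'I_n := (ends d).2.
rewrite -(card_in_imset (f := h)); last first.
  move=> d d'; rewrite !inE => /andP[/eqP t _] /andP[/eqP t' _] hh.
  by apply: dart_eq; rewrite ?t // /head -/(h d) hh.
apply: eq_card => w; rewrite inE; apply/imsetP/andP => [[d + ->]|[wv Aw]].
  by rewrite inE => /andP[/eqP <- ->]; rewrite eq_sym tail_neq_head.
have [|d td hd] := ex_dart vn (ltn_ord w); first by rewrite eq_sym.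
by exists d; [rewrite inE td eqxx hd | apply/val_inj/esym].
Qed.

Local Notation cyl := (cylinder tail).

Local Notation count := (count_cyl tail).

Lemma count_cyl_wrong_tail S Q x y : tail y != tail x -> count ((x, y) :: S) Q = 0.
Proof.
move=> yx; apply: count_cyl_false => s sS; case/eqP: yx.
by rewrite -(cylinder_arc (mem_head _ _) sS) (cylinder_perm x sS).
Qed.

(* The face walk that uses the value s x next leaves {0, ..., k-1} for the first
   time at k'; the number m of steps is fuel. *)
Fixpoint exits (k k' m : nat) s x : bool :=
  if m is m'.+1 then
    if head (s x) < k then exits k k' m' s (flip (s x)) else head (s x) == k'
  else false.

(* Induction along the walk: S records the arcs exposed so far.  The darts to k'
   do not occur in S, whereas a dart to k may be the first source in S. *)
Lemma leq_exits k k' m S x : k < k' < n -> tail x < k -> head x <= k ->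
    {in S, forall p, head p.1 <= k} ->
    {in S, forall p, (tail p.2 < k) && (head p.2 < k)} ->
  count S (exits k k m ^~ x) <= count S (exits k k' m ^~ x).
Proof.
move=> /andP[kk' k'n]; elim: m S x => [|m IH] S x tx hx S1 S2.
  by rewrite count_cyl_false.
have [|xS] := boolP (x \in unzip1 S).
  case/mapP=> -[z y] xyS /= E; move: xyS; rewrite -E {z E} => xyS.
  have /andP[/= ty hy] := S2 _ xyS.
  rewrite (@eq_count_cyl _ _ _ _ _ (exits k k m ^~ (flip y))); last first.
    by move=> s /(cylinder_arc xyS) sx; rewrite /= sx hy.
  rewrite [leqRHS](@eq_count_cyl _ _ _ _ _ (exits k k' m ^~ (flip y))); last first.
    by move=> s /(cylinder_arc xyS) sx; rewrite /= sx hy.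
  by apply: IH => //; rewrite head_flip ltnW.
have kn : k < n := ltn_trans kk' k'n.
have [u tu hu] : exists2 u, tail u = tail x & head u = k.
  by apply: ex_dart; rewrite ?tail_lt // neq_ltn tx.
have [u' tu' hu'] : exists2 u', tail u' = tail x & head u' = k'.
  by apply: ex_dart; rewrite ?tail_lt // neq_ltn (ltn_trans tx).
rewrite (count_cyl_split _ _ _ x) [leqRHS](count_cyl_split _ _ _ x).
(* Values are matched by exchanging the exit [u] to [k] with the exit [u'] to [k']; all others are
   compared with themselves. *)
rewrite [leqRHS](reindex_inj (@perm_inj _ (tperm u u'))) /=; apply: leq_sum => y _.
have [ty|ty] := eqVneq (tail y) (tail x); last by rewrite count_cyl_wrong_tail.
have sE s z : s \in cyl ((x, z) :: S) -> s x = z by exact/cylinder_arc/mem_head.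
have [hy|hy] := ltnP (head y) k.
  rewrite tpermD; first last.
  - by apply: contraTneq hy => <-; rewrite hu' -leqNgt ltnW.
  - by apply: contraTneq hy => <-; rewrite hu ltnn.
  rewrite (@eq_count_cyl _ _ _ _ _ (exits k k m ^~ (flip y))) => [|s /sE /= ->];
    last by rewrite hy.
  rewrite [leqRHS](@eq_count_cyl _ _ _ _ _ (exits k k' m ^~ (flip y))) => [|s /sE /= ->];
    last by rewrite hy.
  apply: IH; rewrite ?tail_flip ?head_flip ?ty // 1?ltnW // => p; rewrite inE.
    by case/predU1P=> [->//|/S1].
  by case/predU1P=> [->|/S2 //]; rewrite /= ty tx hy.
have [hyk|hyk] := eqVneq (head y) k; last first.
  by rewrite count_cyl_false // => s /sE /= ->; rewrite ltnNge hy /= (negPf hyk).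
have -> : y = u by apply: dart_eq; rewrite ?ty ?hyk.
(* The matched value certainly exits at [k'], so it is enough to compare the two cylinders. *)
rewrite tpermL; apply: leq_trans (count_cyl_le _ _ _) _.
have -> : count ((x, u') :: S) (exits k k' m.+1 ^~ x) = #|cyl ((x, u') :: S)|.
  apply: eq_card => s; rewrite [LHS]inE andb_idr // => /sE /= ->.
  by rewrite hu' eqxx ltnNge ltnW.
apply: leq_cylinder_switch => //.
- by apply: contraTneq hx => ->; rewrite hu' -ltnNge.
- by apply/mapP=> -[p /S1 + uE]; rewrite -uE hu' leqNgt kk'.
- by apply/mapP=> -[p /S2 + uE]; rewrite /= -uE hu' [k' < k]ltnNge (ltnW kk') andbF.
Qed.

(* The darts other than d that a face may use if d is its lexicographically
   maximal dart. *)
Definition below d y : bool :=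
  (tail y < tail d) && (head y <= tail d) || (tail y == tail d) && (head y < head d).

(* The face walk that uses the value s x next reaches d within m steps, through
   darts below d. *)
Fixpoint closes d m s x : bool :=
  if m is m'.+1 then (s x == d) || below d (s x) && closes d m' s (flip (s x))
  else false.

(** After contraction the free sources at this vertex form a single cycle. If there are at least
    two, none is its own image; the [.-1] removes that value. *)
Definition free_sources d S := #|[set b | (tail d == tail b) && (b \notin unzip1 S)]|.-1.
Definition free_targets d S :=
  #|[set b | [&& tail b == tail d, head b < head d & b \notin unzip2 S]]|.

Lemma below_neq d y : below d y -> y != d.
Proof. by apply: contraTneq => ->; rewrite /below !ltnn andbF. Qed.

Lemma head_below d y : head d < tail d -> below d y -> head y <= tail d.
Proof.
by move=> hd /orP[/andP[]//|/andP[_ hy]]; rewrite ltnW // (ltn_trans hy).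
Qed.

(* N = Nd + Sb counts the rotations that close at once and those that go on
   through one of b free darts, among C rotations with M equally likely values. *)
Lemma closing_step (M b C N Nd Sb Cd Cb : nat) :
  b < M -> N <= Nd + Sb -> Nd <= Cd -> Cd * M <= C -> Sb * (M - b) <= Cb ->
  Cb * M <= b * C -> N * (M - b) <= C.
Proof.
move=> bM HN HNd HCd HSb HCb; rewrite -(leq_pmul2r (leq_ltn_trans (leq0n b) bM)).
apply: leq_trans (_ : (Nd + Sb) * (M - b) * M <= _); first by rewrite !leq_mul2r HN !orbT.
have -> : C * M = C * (M - b) + C * b by rewrite -mulnDr subnK // ltnW.
rewrite !mulnDl [Nd * _ * M]mulnAC leq_add //.
  by rewrite leq_mul2r (leq_trans _ HCd) ?orbT // leq_mul2r HNd orbT.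
by rewrite [C * b]mulnC (leq_trans _ HCb) // leq_mul2r HSb orbT.
Qed.

(** With [M] free sources and [b] free targets, a new value at the tail of [d] closes the face with
    chance at most 1/M and goes on through one of [b] darts, each with chance at most 1/M. Going on
    lowers both [M] and [b] by one, so by induction the total is at most 1/M + (b/M)/(M - b) = 1/(M
    - b). *)
Lemma closes_bound d m S x : head d < tail d -> tail x <= tail d ->
    {in S, forall p, below d p.2} ->
  count S (closes d m ^~ x) * (free_sources d S - free_targets d S) <= #|cyl S|.
Proof.
move=> hd; elim: m S x => [|m IH] S x tx S2.
  by rewrite count_cyl_false.
have [|xS] := boolP (x \in unzip1 S).
  case/mapP=> -[z y] xyS /= E; move: xyS; rewrite -E {z E} => xyS; have yd := S2 _ xyS.
  rewrite (@eq_count_cyl _ _ _ _ _ (closes d m ^~ (flip y))).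
    by apply: IH; rewrite ?tail_flip ?head_below.
  by move=> s /(cylinder_arc xyS) sx; rewrite /= sx yd (negPf (below_neq yd)).
have sE s z : s \in cyl ((x, z) :: S) -> s x = z by exact/cylinder_arc/mem_head.
have next y : below d y ->
    count ((x, y) :: S) (closes d m.+1 ^~ x) *
      (free_sources d ((x, y) :: S) - free_targets d ((x, y) :: S)) <= #|cyl ((x, y) :: S)|.
  move=> yd; rewrite (@eq_count_cyl _ _ _ _ _ (closes d m ^~ (flip y))).
    apply: IH; first by rewrite tail_flip head_below.
    by move=> p; rewrite inE => /predU1P[->//|/S2].
  by move=> s /sE sx; rewrite /= sx yd (negPf (below_neq yd)).
have stop y : y != d -> ~~ below d y -> count ((x, y) :: S) (closes d m.+1 ^~ x) = 0.
  move=> yd ydl; apply: count_cyl_false => s /sE /= ->.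
  by rewrite (negPf yd) (negPf ydl).
rewrite (count_cyl_split _ _ _ x).
(* Away from the tail of [d] a new arc removes no free source and adds no free target. *)
have [tx_lt|tx_ge] := ltnP (tail x) (tail d).
  rewrite (card_cylinder_split _ _ x) big_distrl /=; apply: leq_sum => y _.
  have [ty|ty] := eqVneq (tail y) (tail x); last by rewrite count_cyl_wrong_tail.
  have [yd|yd] := boolP (below d y); last first.
    by rewrite stop //; apply: contraTneq tx_lt => yd'; rewrite -ty yd' ltnn.
  apply: leq_trans (next y yd); rewrite leq_mul2l; apply/orP; right.
  rewrite leq_sub // /free_sources /free_targets.
    rewrite -!subn1 leq_sub2r //; apply: subset_leq_card; apply/subsetP=> b.
    rewrite !inE negb_or => /andP[tb ->]; rewrite tb andbT /=.
    by apply: contraTneq tb => ->; rewrite neq_ltn tx_lt orbT.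
  by apply: subset_leq_card; apply/subsetP=> b; rewrite !inE negb_or => /and4P[-> -> _ ->].
have {tx_ge} tx_eq : tail x = tail d by apply/eqP; rewrite eqn_leq tx.
set M := free_sources d S; set b := free_targets d S.
have [Mb|bM] := leqP M b; first by rewrite (eqP Mb) muln0.
pose B := [set y | [&& tail y == tail d, head y < head d & y \notin unzip2 S]].
have arc y : #|cyl ((x, y) :: S)| * M <= #|cyl S|.
  have := card_cylinder_cons tail y xS.
  by rewrite /M /free_sources tx_eq.
apply: (@closing_step M b _ _ (count ((x, d) :: S) (closes d m.+1 ^~ x))
  (\sum_(y in B) count ((x, y) :: S) (closes d m.+1 ^~ x))
  #|cyl ((x, d) :: S)| (\sum_(y in B) #|cyl ((x, y) :: S)|)).
- exact: bM.
- rewrite (bigD1 d) //= leq_add2l (bigID (mem B)) /= -[leqRHS]addn0; apply: leq_add.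
    rewrite big_mkcondl /= big_mkcond [leqRHS]big_mkcond; apply: leq_sum => y _.
    by case: ifP => //; case: ifP.
  rewrite leqn0; apply/eqP/big1 => y /andP[yd yB].
  have [ty|ty] := eqVneq (tail y) (tail x); last by rewrite count_cyl_wrong_tail.
  have [yl|yl] := boolP (below d y); last exact: stop.
  have hy : head y < head d by move: yl; rewrite /below ty tx_eq ltnn eqxx.
  (* Such a value is already the image of an exposed source, while [x] is not exposed; injectivity
     excludes it. *)
  move: yB; rewrite inE ty tx_eq eqxx hy /= negbK => /mapP[[x' y'] xyS /= yE].
  apply: count_cyl_false => s sS; case/negP: xS.
  have sx : s x = s x'.
    rewrite (sE _ _ sS) yE; apply/esym; apply: cylinder_arc sS.
    by rewrite inE xyS orbT.
  by rewrite (perm_inj sx); apply/mapP; exists (x', y').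
- exact: count_cyl_le.
- exact: arc.
- rewrite big_distrl /=; apply: leq_sum => y; rewrite inE => /and3P[/eqP ty hy yS].
  have yd : below d y by rewrite /below ty eqxx hy orbT.
  suff -> : M - b = free_sources d ((x, y) :: S) - free_targets d ((x, y) :: S) by exact: next.
  have -> : M = (free_sources d ((x, y) :: S)).+1.
    have ME : M = #|[set z | (tail d == tail z) && (z \notin unzip1 S)] :\ x|.
      by rewrite /M /free_sources (cardsD1 x) inE tx_eq eqxx xS.
    rewrite ME -[LHS]prednK; last by rewrite -ME (leq_ltn_trans (leq0n b)).
    congr _.-1.+1; apply: eq_card => z; rewrite !inE negb_or.
    by rewrite andbCA.
  have -> : b = (free_targets d ((x, y) :: S)).+1.
    rewrite /b /free_targets (cardsD1 y) inE ty eqxx hy yS /= add1n; congr _.+1.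
    by apply: eq_card => z; rewrite !inE negb_or; case: (z == y); rewrite //= !andbF.
  by rewrite subSS.
- by rewrite big_distrl /= -sum_nat_const; apply: leq_sum => y _; exact: arc.
Qed.

Lemma free_sources_fresh d S : {in S, forall p, tail p.1 < tail d} ->
  free_sources d S = n - 2.
Proof.
move=> S1; have vn := tail_lt d.
have -> : free_sources d S = #|[set b | (tail b == tail d) && predT (head b)]|.-1.
  congr _.-1; apply: eq_card => b; rewrite !inE eq_sym; apply: andb_id2l => /eqP tb.
  by apply/mapP=> -[p /S1 + bE]; rewrite -bE tb ltnn.
rewrite (card_heads predT vn) (_ : [set _ | _] = [set~ (ends d).1]); last first.
  by apply/setP=> w; rewrite !inE andbT.
by rewrite cardsC1 card_ord -subn2.
Qed.

Lemma free_targets_le d S : head d < tail d -> free_targets d S <= head d.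
Proof.
move=> hd; apply: (@leq_trans #|[set b | (tail b == tail d) && gtn (head d) (head b)]|).
  by apply: subset_leq_card; apply/subsetP=> b; rewrite !inE => /and3P[-> ->].
rewrite (card_heads _ (tail_lt d)) -[leqRHS]card_ord -sum1_card.
rewrite -[leqRHS]sum1_card -(big_ord_narrow (ltnW (head_lt d)) (F := fun=> 1)).
rewrite big_mkcond [leqRHS]big_mkcond.
by apply: leq_sum => w _; rewrite inE; case: ifP => // /andP[_ /= ->].
Qed.

(** Until its first exit from the vertices smaller than [tail d] the walk exposes no source at
    [tail d]. An exit beyond [tail d] rules out closing; at an exit to [tail d], [closes_bound]
    applies with [n - 2] free sources and at most [head d] free targets. *)
Lemma closes_exits d m S x : head d < tail d -> tail x < tail d ->
    {in S, forall p, [&& tail p.1 < tail d, tail p.2 < tail d & head p.2 < tail d]} ->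
  count S (closes d m ^~ x) * (n - 2 - head d) <= count S (exits (tail d) (tail d) m ^~ x).
Proof.
move=> hd; elim: m S x => [|m IH] S x tx S2.
  by rewrite count_cyl_false.
have inner y : tail y < tail d -> head y <= tail d -> (y != d) && below d y.
  move=> ty hy; rewrite /below ty hy /= andbT.
  by apply: contraTneq ty => ->; rewrite ltnn.
have [|xS] := boolP (x \in unzip1 S).
  case/mapP=> -[z y] xyS /= E; move: xyS; rewrite -E {z E} => xyS.
  have /and3P[_ /= ty hy] := S2 _ xyS; have /andP[yd yl] := inner y ty (ltnW hy).
  rewrite (@eq_count_cyl _ _ _ _ _ (closes d m ^~ (flip y))); last first.
    by move=> s /(cylinder_arc xyS) sx; rewrite /= sx yl (negPf yd).
  rewrite [leqRHS](@eq_count_cyl _ _ _ _ _ (exits (tail d) (tail d) m ^~ (flip y))).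
    exact: IH.
  by move=> s /(cylinder_arc xyS) sx; rewrite /= sx hy.
have sE s z : s \in cyl ((x, z) :: S) -> s x = z by exact/cylinder_arc/mem_head.
rewrite (count_cyl_split _ _ _ x) [leqRHS](count_cyl_split _ _ _ x) big_distrl /=.
apply: leq_sum => y _.
have [ty|ty] := eqVneq (tail y) (tail x); last by rewrite count_cyl_wrong_tail.
have [hy|hy|hy] := ltngtP (head y) (tail d).
- have /andP[yd yl] : (y != d) && below d y by apply: inner; rewrite ?ty // ltnW.
  rewrite (@eq_count_cyl _ _ _ _ _ (closes d m ^~ (flip y))); last first.
    by move=> s /sE sx; rewrite /= sx yl (negPf yd).
  rewrite [leqRHS](@eq_count_cyl _ _ _ _ _ (exits (tail d) (tail d) m ^~ (flip y))).
    apply: IH => // p; rewrite inE => /predU1P[->|/S2 //].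
    by rewrite /= ty tx hy.
  by move=> s /sE sx; rewrite /= sx hy.
- rewrite count_cyl_false // => s /sE /= ->.
  rewrite /below (leqNgt (head y)) hy andbF /= ty (ltn_eqF tx) /= orbF.
  by apply: contraTF tx => /eqP <-; rewrite -ty ltnn.
have -> : count ((x, y) :: S) (exits (tail d) (tail d) m.+1 ^~ x) = #|cyl ((x, y) :: S)|.
  by apply: eq_card => s; rewrite [LHS]inE andb_idr // => /sE /= ->; rewrite hy ltnn eqxx.
have S2' : {in (x, y) :: S, forall p, (tail p.1 < tail d) && below d p.2}.
  move=> p; rewrite inE => /predU1P[->|/S2 /and3P[-> tp hp]] /=.
    by rewrite tx /below ty tx hy leqnn.
  by rewrite /below tp ltnW.
apply: leq_trans (closes_bound m.+1 hd (ltnW tx) _) => [|p /S2'/andP[]//].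
rewrite leq_mul2l; apply/orP; right; rewrite (@free_sources_fresh d) => [|p /S2'/andP[]//].
by rewrite leq_sub2l // free_targets_le.
Qed.

End Walks.

(** * Rotation systems as permutations *)

Section RotationCycles.
Variable G : sgraph.
Implicit Types (d : dart G) (R : {ffun vertex G -> {perm dart G}}).

Definition dart_tail d : vertex G := (ends d).1.

Lemma rotation_systemP R v : R \in rotation_systems G ->
  perm_on (darts_at v) (R v) /\ {in darts_at v, forall d, porbit (R v) d = darts_at v}.
Proof.
rewrite inE => /forallP/(_ v)/andP[-> /forall_inP H]; split=> // d /H /eqP //.
Qed.

Lemma prod_perm_on R d (r : seq (vertex G)) : R \in rotation_systems G -> uniq r ->
  (\prod_(v <- r) R v)%g d = if dart_tail d \in r then R (dart_tail d) d else d.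
Proof.
move=> RS; have on v := (rotation_systemP v RS).1.
elim: r d => [|v r IH] d; first by rewrite big_nil perm1.
rewrite big_cons permM inE => /andP[vr ur]; rewrite IH //.
have [tdv|tdv] /= := eqVneq (dart_tail d) v; last first.
  by rewrite (out_perm (on v)) // inE.
have -> : dart_tail (R v d) = v.
  by apply/eqP; have := perm_closed d (on v); rewrite !inE => ->; apply/eqP.
by rewrite (negPf vr) tdv.
Qed.

Lemma rotation_prodE R d : R \in rotation_systems G -> rotation_prod R d = R (dart_tail d) d.
Proof.
by move=> RS; rewrite /rotation_prod prod_perm_on ?index_enum_uniq // mem_index_enum.
Qed.

Lemma rotation_prod_cycles_on R : R \in rotation_systems G ->
  rotation_prod R \in cycles_on dart_tail.
Proof.
move=> RS; apply/cycles_onP=> x y.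
have [on orb] := rotation_systemP (dart_tail x) RS.
have xA : x \in darts_at (dart_tail x) by rewrite inE.
transitivity (y \in darts_at (dart_tail x)); last by rewrite inE eq_sym.
rewrite -(orb x xA); set v := dart_tail x.
have E i : (rotation_prod R ^+ i)%g x = (R v ^+ i)%g x.
  elim: i => [|i IH]; first by rewrite !expg0.
  rewrite !expgSr !permM IH rotation_prodE //; congr (R _ _); apply/eqP.
  by have := mem_porbit (R v) i x; rewrite orb // inE.
by apply/porbitP/porbitP => -[i ->]; exists i; rewrite E.
Qed.

Lemma rotation_prod_inj : {in rotation_systems G &, injective (@rotation_prod G)}.
Proof.
move=> R R' RS RS' RR'; apply/ffunP=> v; apply/permP=> d.
have [dv|dv] := boolP (d \in darts_at v).
  have /eqP <- : dart_tail d == v by move: dv; rewrite inE.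
  by rewrite -!rotation_prodE // RR'.
by rewrite (out_perm (rotation_systemP v RS).1) // (out_perm (rotation_systemP v RS').1).
Qed.

(** The inverse of [rotation_prod] restricts a permutation to the darts at each vertex. A uniform
    rotation system thus becomes a uniform element of [cycles_on]. *)
Lemma rotation_prod_imset :
  [set rotation_prod R | R in rotation_systems G] = cycles_on dart_tail.
Proof.
apply/setP=> s; apply/imsetP/idP => [[R RS ->]|sC]; first exact: rotation_prod_cycles_on.
have sN v : s \in ('N(darts_at v | 'P))%g.
  apply/astabsP=> d; rewrite !inE /= apermE.
  by rewrite -[(ends (s d)).1]/(dart_tail (s d)) (cycles_on_perm d sC).
pose R := [ffun v => restr_perm (darts_at v) s].
have RE v d : d \in darts_at v -> R v d = s d by rewrite ffunE; exact: restr_permE.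
have RS : R \in rotation_systems G.
  rewrite inE; apply/forallP=> v; apply/andP; split; first by rewrite ffunE restr_perm_on.
  apply/forall_inP=> d dA; apply/eqP/setP=> y.
  have E i : (R v ^+ i)%g d = (s ^+ i)%g d.
    elim: i => [|i IH]; first by rewrite !expg0.
    rewrite !expgSr !permM IH RE // inE; move/cycles_onP/(_ d ((s ^+ i)%g d)): sC.
    by rewrite mem_porbit => /esym/eqP; rewrite /dart_tail => <-; move: dA; rewrite inE.
  transitivity (y \in porbit s d).
    by apply/porbitP/porbitP => -[i ->]; exists i; rewrite E.
  by move/cycles_onP: sC => ->; move: dA; rewrite !inE => /eqP <-; rewrite eq_sym.
exists R => //; apply/permP=> d; rewrite rotation_prodE // RE //.
by rewrite inE.
Qed.

Local Open Scope ring_scope.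

Lemma expected_faces_cycles_on : expected_faces G =
  (\sum_(s in cycles_on dart_tail) #|porbits (flip_perm G * s)%g|%:R) /
  #|cycles_on dart_tail|%:R.
Proof.
rewrite /expected_faces /uniform_expectation -rotation_prod_imset.
by rewrite (big_imset _ rotation_prod_inj) (card_in_imset rotation_prod_inj).
Qed.

End RotationCycles.

(** * Counting faces by their maximal darts *)

(** Each cycle is the orbit of one of its points of maximal key; ties can only enlarge the
    right-hand side. *)
Lemma card_porbits_le_max (D : finType) (s : {perm D}) (key : D -> nat) :
  #|porbits s| <= #|[set d | [forall y in porbit s d, key y <= key d]]|.
Proof.
apply: leq_trans (leq_imset_card (porbit s) _); apply: subset_leq_card.
apply/subsetP=> _ /imsetP[x _ ->]; apply/imsetP.
have [d dx dmax] := arg_maxnP key (porbit_id s x).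
have dE : porbit s d = porbit s x by apply/eqP; rewrite eq_porbit_mem.
by exists d; rewrite ?dE // inE dE; apply/forall_inP=> y /dmax.
Qed.

Lemma card_setI_sum (T : finType) (A : {set T}) (Q : pred T) :
  #|[set s in A | Q s]| = \sum_(s in A) Q s.
Proof.
rewrite -sum1_card big_mkcond [RHS]big_mkcond; apply: eq_bigr => s _.
by rewrite in_set; case: (s \in A); case: (Q s).
Qed.

Section FaceCount.
Variable n : nat.
Local Open Scope nat_scope.
Notation D := (dart (complete_graph n)).
Local Notation m := #|{: D}|.
Local Notation cyc := (cycles_on (@tail n)).

(** [closes] at [flip y] examines the image of [y] under the face permutation. The number of all
    darts is enough fuel, being at least the length of any face. *)
Lemma closes_iter (s : {perm D}) d i y : i < m ->
    {in porbit (flip_perm _ * s)%g d, forall z, z != d -> below d z} ->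
    y \in porbit (flip_perm _ * s)%g d ->
    iter i.+1 (flip_perm _ * s)%g y = d ->
  closes d m s (flip y).
Proof.
set phi := (flip_perm _ * s)%g => im orb; elim: m i im y => [|k IH] i //= ik y yd.
have phiy z : phi z = s (flip z) by rewrite /phi permM permE.
rewrite -iterS iterSr phiy => E; have [//|ne] /= := eqVneq (s (flip y)) d.
have yd' : s (flip y) \in porbit phi d by rewrite -phiy mem_porbit_perm.
rewrite orb //=; case: i ik E => [_ /= E|i ik E]; first by rewrite E eqxx in ne.
exact: IH E.
Qed.

(** Each head on the face is the tail of the next dart, so the maximality of [tail d] bounds the
    heads as well. *)
Lemma max_closes (s : {perm D}) d : s \in cyc ->
    {in porbit (flip_perm _ * s)%g d, forall y, tail y * n + head y <= tail d * n + head d} ->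
  (head d < tail d) && closes d m s (flip d).
Proof.
move=> sC dmax; set phi := (flip_perm _ * s)%g in dmax *.
have tphi y : tail (phi y) = head y.
  by rewrite /phi permM permE (cycles_on_perm _ sC).
(* Heads are smaller than [n], so the key orders darts lexicographically. *)
have lex y : y \in porbit phi d -> tail y <= tail d /\ (tail y = tail d -> head y <= head d).
  move=> /dmax; have := head_lt y; have := head_lt d; nia.
have hdle y : y \in porbit phi d -> head y <= tail d.
  by move=> yd; rewrite -tphi; case: (lex (phi y)); rewrite ?mem_porbit_perm.
have hd : head d < tail d.
  by rewrite ltn_neqAle eq_sym tail_neq_head hdle ?porbit_id.
rewrite hd /=; have m0 : 0 < #|porbit phi d| by rewrite lt0n card_porbit_neq0.
apply: (@closes_iter s d #|porbit phi d|.-1); rewrite ?porbit_id ?prednK ?iter_porbit //.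
  exact: max_card.
move=> y yd ne; rewrite /below hdle // andbT.
have [ty hy] := lex y yd; case: ltngtP ty => //= E _; rewrite ltn_neqAle hy // andbT.
by apply: contraNneq ne => e; apply/eqP/dart_eq.
Qed.

Lemma exits_unique k k1 k2 j (s : {perm D}) x :
  exits k k1 j s x -> exits k k2 j s x -> k1 = k2.
Proof.
by elim: j x => //= j IH x; case: ifP => [_|_ /eqP <- /eqP //]; exact: IH.
Qed.

Lemma sum_exits_le1 k j (s : {perm D}) x : \sum_(k <= k' < n) exits k k' j s x <= 1.
Proof.
have -> : \sum_(k <= k' < n) exits k k' j s x =
    size [seq k' <- index_iota k n | exits k k' j s x].
  rewrite size_filter -sum1_count [RHS]big_mkcond; apply: eq_bigr => k' _.
  by case: exits.
set r := filter _ _; have: uniq r by rewrite filter_uniq ?iota_uniq.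
have: {in r &, forall k1 k2, k1 = k2}.
  move=> k1 k2; rewrite !mem_filter => /andP[e1 _] /andP[e2 _].
  exact: exits_unique e1 e2.
case: r => [|k1 [|k2 r]] //= rE.
by rewrite (rE k1 k2) ?inE ?eqxx ?orbT.
Qed.

(** First exits at the [n - tail d] vertices from [tail d] on are disjoint events, and by
    [leq_exits] the one at [tail d] is the least frequent; [closes_exits] contributes the other
    factor. *)
Lemma card_closes_le d : head d < tail d ->
  #|[set s in cyc | closes d m s (flip d)]| * (n - 2 - head d) * (n - tail d) <= #|cyc|.
Proof.
move=> hd; have cE : cylinder (@tail n) [::] = cyc by apply/setP=> s; rewrite in_set andbT.
pose X k := #|[set s in cyc | exits (tail d) k m s (flip d)]|.
have H0 : #|[set s in cyc | closes d m s (flip d)]| * (n - 2 - head d) <= X (tail d).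
  by have := @closes_exits n d m [::] (flip d) hd hd; rewrite /count_cyl cE; apply.
apply: leq_trans (_ : X (tail d) * (n - tail d) <= _); first by rewrite leq_mul2r H0 orbT.
apply: (@leq_trans (\sum_(tail d <= k < n) X k)).
  rewrite mulnC -sum_nat_const_nat big_nat_cond [leqRHS]big_nat_cond; apply: leq_sum => k.
  rewrite andbT leq_eqVlt => /andP[/predU1P[<- //|dk] kn].
  have := @leq_exits n (tail d) k m [::] (flip d); rewrite /count_cyl cE dk kn; apply=> //.
rewrite -[leqRHS]sum1_card.
apply: (@leq_trans (\sum_(s in cyc) \sum_(tail d <= k < n) exits (tail d) k m s (flip d))).
  by rewrite exchange_big /=; apply: leq_sum => k _; rewrite /X card_setI_sum.
by apply: leq_sum => s _; exact: sum_exits_le1.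
Qed.

Lemma sum_card_porbits_le :
  \sum_(s in cyc) #|porbits (flip_perm (complete_graph n) * s)%g| <=
  \sum_(d : D | head d < tail d) #|[set s in cyc | closes d m s (flip d)]|.
Proof.
apply: (@leq_trans (\sum_(s in cyc) \sum_(d : D | head d < tail d) closes d m s (flip d))).
  apply: leq_sum => s sC.
  apply: leq_trans (card_porbits_le_max _ (fun d => tail d * n + head d)) _.
  rewrite -sum1_card big_mkcond [leqRHS]big_mkcond; apply: leq_sum => d _.
  case: ifP => //; rewrite in_set => /forall_inP dmax.
  by case/andP: (max_closes sC dmax) => -> ->.
rewrite exchange_big /=; apply: leq_sum => d _.
by rewrite card_setI_sum.
Qed.

End FaceCount.

(** * Harmonic sums *)

Section Harmonic.
Local Open Scope ring_scope.

Notation H := harmonic_number.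

Lemma harmonicS k : H k.+1 = H k + k.+1%:R^-1.
Proof. by rewrite /H big_nat_recr. Qed.

Lemma harmonic0 : H 0 = 0.
Proof. by rewrite /H big_geq. Qed.

Lemma harmonic_ge0 k : 0 <= H k.
Proof. by apply: sumr_ge0 => j _; rewrite invr_ge0 ler0n. Qed.

(* True for all t because of truncated subtraction and 0^-1 = 0. *)
Lemma harmonic_sub N t : \sum_(0 <= w < t) (N - w)%:R^-1 = H N - H (N - t).
Proof.
elim: t => [|t IH]; first by rewrite big_nil subn0 subrr.
rewrite big_nat_recr //= IH subnS; case: (N - t)%N => [|k]; first by rewrite invr0 addr0.
by rewrite harmonicS /= opprD addrA subrK.
Qed.

(** Applied at [n - 2], hence the start at 8; each further term is at most 1/2. *)
Lemma harmonic_le_half k : (8 <= k)%N -> H k <= k%:R / 2.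
Proof.
elim: k => [|k IH]; first by rewrite ltn0.
rewrite leq_eqVlt => /predU1P[<-|k8].
  by rewrite !harmonicS harmonic0; lra.
have Hk := IH k8; rewrite harmonicS -[X in _ <= X / 2]natr1.
have inv_le : (k.+1%:R : rat)^-1 <= 2^-1 by rewrite lef_pV2 ?posrE ?ltr0n // ler_nat; lia.
by rewrite mulrDl mul1r lerD.
Qed.

(* For w = n - 2 the first term is 0^-1 = 0 and the bound is the trivial one, 1. *)
Definition arc_bound n t w : rat := ((n - 2 - w) * (n - t))%:R^-1 + (w == n - 2)%N%:R.

Lemma arc_bound_ge0 n t w : 0 <= arc_bound n t w.
Proof. by rewrite addr_ge0 ?invr_ge0 ?ler0n. Qed.

Lemma sum_arc_bound n : (2 <= n)%N ->
  \sum_(0 <= t < n) \sum_(0 <= w < t) arc_bound n t w =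
  1 + \sum_(1 <= a < n) a%:R^-1 * (H (n - 2) - H (a - 2)).
Proof.
move=> n2.
have sum_eq k : \sum_(0 <= w < k) (w == n - 2)%N%:R = (n - 2 < k)%N%:R :> rat.
  elim: k => [|k IH]; first by rewrite big_nil.
  by rewrite big_nat_recr //= IH ltnS -natrD; case: ltngtP.
rewrite (eq_bigr (fun t => (n - t)%:R^-1 * (H (n - 2) - H (n - 2 - t)) + (n - 2 < t)%N%:R)).
  rewrite big_split /= addrC; congr (_ + _).
    (* Only t = n - 1 satisfies n - 2 < t, which yields the 1. *)
    case: n n2 {sum_eq} => [|[|k]] // _; rewrite subn2 /= !big_nat_recr //= ltnn ltnSn.
    rewrite big_nat_cond big1 ?add0r // => t /andP[/andP[_ tk] _].
    by rewrite ltnNge ltnW.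
  (* Substitution a = n - t; the term a = n vanishes. *)
  transitivity (\sum_(1 <= a < n.+1) a%:R^-1 * (H (n - 2) - H (a - 2))).
    rewrite big_add1 /= big_nat_rev /=; apply: eq_big_nat => t /andP[_ tn].
    by congr ((_%:R)^-1 * (_ - H _)); lia.
  by rewrite big_nat_recr ?(ltnW n2) //= subrr mulr0 addr0.
move=> t _; rewrite big_split sum_eq; congr (_ + _).
rewrite -harmonic_sub mulr_sumr; apply: eq_bigr => w _.
by rewrite natrM invfM mulrC.
Qed.

(** H_{n-1} exceeds H_{n-3} by 1/(n-2) + 1/(n-1), which costs at most 1 after multiplication by
    H_{n-2} <= (n-2)/2. With the leading 1 this makes 2, and the terms with a < 10 of the subtracted
    sum already exceed 2. *)
Lemma sum_harmonic_bound n : (10 <= n)%N ->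
  1 + \sum_(1 <= a < n) a%:R^-1 * (H (n - 2) - H (a - 2)) < H (n - 3) * H (n - 2).
Proof.
move=> n10; set h := H (n - 2).
have -> : \sum_(1 <= a < n) a%:R^-1 * (h - H (a - 2)) =
    H n.-1 * h - \sum_(1 <= a < n) a%:R^-1 * H (a - 2).
  rewrite /H prednK; last by lia.
  by rewrite mulr_suml -sumrB; apply: eq_bigr => a _; rewrite mulrBr.
have c : 2 < \sum_(1 <= a < n) (a%:R^-1 : rat) * H (a - 2).
  rewrite (big_cat_nat (n := 10)) //=.
  apply: (@lt_le_trans _ _ (\sum_(1 <= a < 10) (a%:R^-1 : rat) * H (a - 2))).
    do 9!rewrite big_nat_recr //=; rewrite big_geq // ?subSS ?sub0n ?subn0.
    by rewrite !harmonicS harmonic0; lra.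
  by rewrite lerDl; apply: sumr_ge0 => a _; rewrite mulr_ge0 ?harmonic_ge0 ?invr_ge0 ?ler0n.
have h2 : h <= (n - 2)%:R / 2 by apply: harmonic_le_half; lia.
have -> : H n.-1 = H (n - 3) + (n - 2)%:R^-1 + (n - 1)%:R^-1.
  by rewrite (_ : n.-1 = (n - 3).+2) ?harmonicS; [congr (_ + _^-1 + _^-1); congr _%:R|]; lia.
have N0 : (0 : rat) < (n - 2)%:R by rewrite ltr0n; lia.
have N1 : ((n - 1)%:R : rat)^-1 <= (n - 2)%:R^-1.
  by rewrite lef_pV2 ?posrE ?ltr0n ?ler_nat; lia.
have : h * (n - 2)%:R^-1 <= 2^-1 by rewrite ler_pdivrMr // mulrC.
have : h * (n - 1)%:R^-1 <= h * (n - 2)%:R^-1 by apply: ler_wpM2l => //; exact: harmonic_ge0.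
rewrite !mulrDl [_^-1 * h]mulrC [_^-1 * h]mulrC.
move: c; lra.
Qed.

Lemma leq_arc_bound n t w x c : (t < n)%N -> (w < t)%N -> (x <= c)%N ->
  (x * (n - 2 - w) * (n - t) <= c)%N -> x%:R <= arc_bound n t w * c%:R.
Proof.
move=> tn wt xc xpc; rewrite /arc_bound; have [->|wn] := eqVneq w (n - 2)%N.
  by rewrite subnn invr0 add0r mul1r ler_nat.
have p_gt0 : (0 < (n - 2 - w) * (n - t))%N by rewrite muln_gt0 !subn_gt0 tn andbT; lia.
by rewrite addr0 mulrC ler_pdivlMr ?ltr0n // -natrM ler_nat mulnA.
Qed.

Lemma sum_darts n (F : nat -> nat -> rat) :
  \sum_(d : dart (complete_graph n) | (head d < tail d)%N) F (tail d) (head d) =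
  \sum_(0 <= t < n) \sum_(0 <= w < t) F t w.
Proof.
rewrite big_mkord (eq_bigr (fun t : 'I_n => \sum_(w < n | (w < t)%N) F t w)); last first.
  by move=> t _; rewrite big_mkord (big_ord_widen _ _ (ltnW (ltn_ord t))).
rewrite pair_big_dep /=.
pose A : {set dart (complete_graph n)} := [set d | (head d < tail d)%N].
rewrite (eq_bigl (fun d => d \in A)); last by move=> d; rewrite inE.
pose h (d : dart (complete_graph n)) : 'I_n * 'I_n := ends d.
rewrite -(big_imset (fun p => F p.1 p.2) (h := h)); last first.
  by move=> d d' _ _ dd'; apply: val_inj.
apply: eq_bigl => -[t w] /=; apply/imsetP/idP => [[d + e]|wt].
  by rewrite inE /head /tail -[ends d]/(h d) -e.
have [|d td hd] := ex_dart (ltn_ord t) (ltn_ord w); first by rewrite neq_ltn wt orbT.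
exists d; first by rewrite inE td hd.
by rewrite [h d]surjective_pairing; congr pair; apply: val_inj.
Qed.

End Harmonic.

(** * Expected number of faces as a sum over darts *)

Local Open Scope ring_scope.

Lemma expected_faces_le n :
  expected_faces (complete_graph n) <= \sum_(0 <= t < n) \sum_(0 <= w < t) arc_bound n t w.
Proof.
rewrite expected_faces_cycles_on (@eq_cycles_on _ _ _ _ (@tail n)) => [|a b]; last first.
  by rewrite /dart_tail -val_eqE.
rewrite -natr_sum.
have: ((\sum_(s in cycles_on (@tail n))
      #|porbits (flip_perm (complete_graph n) * s)%g|)%N%:R : rat)
    <= (\sum_(0 <= t < n) \sum_(0 <= w < t) arc_bound n t w) * #|cycles_on (@tail n)|%:R.
  rewrite -sum_darts mulr_suml.
  apply: le_trans (_ : (\sum_(d | (head d < tail d)%N)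
     #|[set s in cycles_on (@tail n) |
         closes d #|{: dart (complete_graph n)}| s (flip d)]|)%N%:R <= _).
    by rewrite ler_nat sum_card_porbits_le.
  rewrite natr_sum; apply: ler_sum => d hd; apply: (leq_arc_bound (tail_lt d) hd).
    by apply: subset_leq_card; apply/subsetP=> s; rewrite inE => /andP[].
  exact: card_closes_le.
(* Over an empty set the quotient is 0, since 0^-1 = 0. *)
have [->|c_neq0] := eqVneq #|cycles_on (@tail n)| 0%N.
  rewrite mulr0n invr0 !mulr0 => _; apply: sumr_ge0 => t _; apply: sumr_ge0 => w _.
  exact: arc_bound_ge0.
by rewrite ler_pdivrMr // ltr0n lt0n.
Qed.

Theorem theorem1p7 (n : nat) (hn : (10 <= n)%N) :
  expected_faces (complete_graph n)
    < harmonic_number (n - 3) * harmonic_number (n - 2).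
Proof.
apply: le_lt_trans (expected_faces_le n) _.
by rewrite sum_arc_bound ?(leq_trans _ hn) // sum_harmonic_bound.
Qed.
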